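(* Let $G$ be a finite connected simple graph on $[d]$ and suppose $\mathcal{H}$ is a separating hyperplane of the edge polytope $\mathcal{P}_G$, so that $\mathcal{P}_G=\mathcal{P}_{G_+}\cup\mathcal{P}_{G_-}$ with $\mathcal{P}_{G_+}=\mathcal{P}_G\cap\mathcal{H}^{(+)}$ and $\mathcal{P}_{G_-}=\mathcal{P}_G\cap\mathcal{H}^{(-)}$. Then $\mathcal{P}_G$ is normal if and only if both $\mathcal{P}_{G_+}$ and $\mathcal{P}_{G_-}$ are normal.
   Context: For an edge $e=(i,j)$ of a graph on vertex set $[d]=\{1,\dots,d\}$, put $\rho(e)=\mathbf{e}_i+\mathbf{e}_j\in\mathbb{R}^d$, where $\mathbf{e}_i$ is the $i$-th unit coordinate vector. The edge polytope $\mathcal{P}_G$ is the convex hull of $\{\rho(e): e\in E(G)\}$. For a hyperplane $\mathcal{H}\subset\mathbb{R}^d$, $\mathcal{H}^{(+)}$ and $\mathcal{H}^{(-)}$ denote the two closed half-spaces with $\mathcal{H}^{(+)}\cap\mathcal{H}^{(-)}=\mathcal{H}$. A polytope is integral if all its vertices lie in $\mathbb{Z}^d$. A separating hyperplane of a polytope $P$ is a hyperplane $\mathcal{H}$ meeting the relative interior of $P$ (and not containing $P$) such that both $P\cap\mathcal{H}^{(+)}$ and $P\cap\mathcal{H}^{(-)}$ are integral. Here $G_+$ (resp. $G_-$) is the spanning subgraph of $G$ on $[d]$ whose edges are the $e\in E(G)$ with $\rho(e)\in\mathcal{H}^{(+)}$ (resp. $\rho(e)\in\mathcal{H}^{(-)}$);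 one has $\mathcal{P}_G\cap\mathcal{H}^{(\pm)}=\mathcal{P}_{G_\pm}$. An integral polytope $\mathcal{P}\subset\mathbb{R}^d$ is normal if for every positive integer $N$ and every $\beta\in N\mathcal{P}\cap\mathbb{Z}^d$ (where $N\mathcal{P}=\{N\alpha:\alpha\in\mathcal{P}\}$) there exist $\beta_1,\dots,\beta_N\in\mathcal{P}\cap\mathbb{Z}^d$ with $\beta=\beta_1+\cdots+\beta_N$. *)

(* Defs.v *)
From HB Require Import structures.
From mathcomp Require Import all_boot all_order all_algebra.
From mathcomp Require Import boolp classical_sets reals topology normedtype.

Set Implicit Arguments.
Unset Strict Implicit.
Unset Printing Implicit Defensive.

Import Order.TTheory GRing.Theory Num.Theory.
Import numFieldNormedType.Exports.

Local Open Scope classical_set_scope.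
Local Open Scope ring_scope.

Section Polytopes.
Variables (R : realType) (d : nat).
Implicit Types (S P H : set 'rV[R]_d) (a x : 'rV[R]_d) (b : R).

Definition dot a x : R := \sum_(i < d) a 0 i * x 0 i.

Definition affine_hull S : set 'rV[R]_d :=
  [set x | exists (n : nat) (t : 'I_n -> R) (y : 'I_n -> 'rV[R]_d),
     [/\ \sum_k t k = 1, forall k, S (y k) & x = \sum_k t k *: y k]].

Definition convex_hull S : set 'rV[R]_d :=
  [set x | exists (n : nat) (t : 'I_n -> R) (y : 'I_n -> 'rV[R]_d),
     [/\ forall k, 0 <= t k, \sum_k t k = 1, forall k, S (y k)
       & x = \sum_k t k *: y k]].

(* The interior of P for the topology induced on its affine hull. *)
Definition relative_interior P : set 'rV[R]_d :=
  [set x | P x /\ \forall z \near x, affine_hull P z -> P z].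

(* Vertices are taken as the extreme points. *)
Definition vertex P : set 'rV[R]_d :=
  [set v | P v /\ forall (x y : 'rV[R]_d) (t : R), P x -> P y ->
     0 < t < 1 -> v = t *: x + (1 - t) *: y -> x = v /\ y = v].

Definition lattice : set 'rV[R]_d := [set x | x \is a mxOver Num.int].

Definition integral_polytope P : Prop := vertex P `<=` lattice.

Definition dilate (N : nat) P : set 'rV[R]_d := [set N%:R *: x | x in P].

Definition normal_polytope P : Prop :=
  forall (N : nat) (beta : 'rV[R]_d), (0 < N)%N ->
    (dilate N P `&` lattice) beta ->
    exists betas : 'I_N -> 'rV[R]_d,
      (forall k, (P `&` lattice) (betas k)) /\ beta = \sum_k betas k.

(* These describe a hyperplane and its two closed sides only when a != 0. *)
Definition hyperplane a b : set 'rV[R]_d := [set x | dot a x = b].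
Definition halfspace_pos a b : set 'rV[R]_d := [set x | b <= dot a x].
Definition halfspace_neg a b : set 'rV[R]_d := [set x | dot a x <= b].

Definition separating_hyperplane a b P : Prop :=
  [/\ a != 0,
      hyperplane a b `&` relative_interior P !=set0,
      ~ P `<=` hyperplane a b,
      integral_polytope (P `&` halfspace_pos a b)
    & integral_polytope (P `&` halfspace_neg a b)].

Definition rho (i j : 'I_d) : 'rV[R]_d := delta_mx 0 i + delta_mx 0 j.

Definition edge_polytope (G : rel 'I_d) : set 'rV[R]_d :=
  convex_hull [set x | exists i j, G i j /\ x = rho i j].

(* G_+ and G_-, for H one of the two closed half-spaces. *)
Definition edges_in (G : rel 'I_d) H : rel 'I_d :=
  [rel i j | G i j && (rho i j \in H)].

End Polytopes.

Arguments edge_polytope R {d} G.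

(* Main.v *)
Require Import Defs.
From HB Require Import structures.
From mathcomp Require Import all_boot all_order all_algebra.
From mathcomp Require Import boolp classical_sets reals topology normedtype.
From mathcomp Require Import ring lra.

(** Integrality of a half [P_G ∩ H^(+)] forbids a one-dimensional face of [P_G]
    whose ends lie strictly on opposite sides of [H], because its crossing point
    with [H] would be a non-integral vertex.  A segment joining [rho e] to
    [rho e'] is such a face unless [e] and [e'] are disjoint opposite sides of a
    4-cycle of [G], and then the other two sides [f], [f'] of that cycle lie on
    [H], with [rho e + rho e' = rho f + rho f'].  Hence in any nonnegative
    combination of edges, with real or with integral coefficients, the strictly
    positive edges can be traded against the strictly negative ones until only
    one sign remains: both the cone and the monoid generated by [G] are unions of
    those generated by [G_+] and [G_-]. *)

Set Implicit Arguments.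
Unset Strict Implicit.
Unset Printing Implicit Defensive.

Import Order.TTheory GRing.Theory Num.Theory.

Local Open Scope classical_set_scope.
Local Open Scope ring_scope.

(** * Edge vectors, linear forms and cones generated by edges *)

Section Edges.
Variables (R : realType) (d : nat).
Implicit Types (E G : rel 'I_d) (x y : 'rV[R]_d) (i j l : 'I_d) (t : R).
Implicit Type T : {pred R}.

Definition coord_sum x : R := \sum_i x 0 i.

Definition linear_form (c : 'I_d -> R) x : R := \sum_i c i * x 0 i.

Lemma linear_formP c t x y :
  linear_form c (t *: x + y) = t * linear_form c x + linear_form c y.
Proof.
rewrite /linear_form mulr_sumr -big_split /=; apply: eq_bigr => i _.
by rewrite !mxE; ring.
Qed.

Lemma linear_form0 c : linear_form c 0 = 0.
Proof. by apply: big1 => i _; rewrite mxE mulr0. Qed.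

Lemma linear_formZ c t x : linear_form c (t *: x) = t * linear_form c x.
Proof. by rewrite -[_ *: _]addr0 linear_formP linear_form0 addr0. Qed.

Lemma rho_coord i j k : rho R i j 0 k = (k == i)%:R + (k == j)%:R.
Proof. by rewrite /rho !mxE eqxx. Qed.

Lemma comb_coord t i j x k :
  (t *: rho R i j + x) 0 k = t * ((k == i)%:R + (k == j)%:R) + x 0 k.
Proof. by rewrite -rho_coord !mxE. Qed.

Lemma rhoC i j : rho R i j = rho R j i.
Proof. by rewrite /rho addrC. Qed.

Lemma linear_form_rho c i j : linear_form c (rho R i j) = c i + c j.
Proof.
rewrite /linear_form.
under eq_bigr => k _ do rewrite rho_coord mulrDr.
rewrite big_split /=; congr (_ + _).
  by rewrite (bigD1 i) //= eqxx mulr1 big1 ?addr0 // => k /negPf ->; rewrite mulr0.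
by rewrite (bigD1 j) //= eqxx mulr1 big1 ?addr0 // => k /negPf ->; rewrite mulr0.
Qed.

Lemma coord_sumE x : coord_sum x = linear_form (fun=> 1) x.
Proof. by apply: eq_bigr => i _; rewrite mul1r. Qed.

Lemma coord_sumP t x y :
  coord_sum (t *: x + y) = t * coord_sum x + coord_sum y.
Proof. by rewrite !coord_sumE linear_formP. Qed.

Lemma coord_sum_rho i j : coord_sum (rho R i j) = 2.
Proof. by rewrite coord_sumE linear_form_rho. Qed.

Lemma coord_sum0 : coord_sum 0 = 0.
Proof. by rewrite coord_sumE linear_form0. Qed.

Lemma coord_sumZ t x : coord_sum (t *: x) = t * coord_sum x.
Proof. by rewrite !coord_sumE linear_formZ. Qed.

(** The coefficient set [T] lets one induction serve both the real cone ([predT]) and the monoid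
    generated by the edges ([Num.int]). *)
Inductive edge_cone (T : {pred R}) E : 'rV[R]_d -> Prop :=
| EdgeCone0 : edge_cone T E 0
| EdgeConeD t i j x of 0 < t & t \in T & E i j & edge_cone T E x :
    edge_cone T E (t *: rho R i j + x).

Lemma edge_cone_add T E x y :
  edge_cone T E x -> edge_cone T E y -> edge_cone T E (x + y).
Proof.
elim=> [|t i j {}x t0 tT Eij _ IH] Cy; first by rewrite add0r.
by rewrite -addrA; apply: EdgeConeD => //; exact: IH.
Qed.

Lemma edge_cone1 T E t i j :
  0 < t -> t \in T -> E i j -> edge_cone T E (t *: rho R i j).
Proof.
by move=> t0 tT Eij; rewrite -[_ *: _]addr0; apply: EdgeConeD => //; left.
Qed.

Lemma edge_cone_sub T E G x :
  subrel E G -> edge_cone T E x -> edge_cone T G x.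
Proof.
move=> EG; elim=> [|t i j {}x t0 tT Eij _ IH]; first by left.
by apply: EdgeConeD => //; exact: EG.
Qed.

(** Without loops, a term [t *: rho R j k] adds at most [t] to coordinate [i], but always [2 * t] to
    the coordinate sum. *)
Lemma edge_cone_coord T E x i : irreflexive E -> edge_cone T E x ->
  0 <= x 0 i /\ 2 * x 0 i <= coord_sum x.
Proof.
move=> irrE; elim=> [|t j k {}x t0 _ Ejk _ [x0 x1]].
  by rewrite mxE coord_sum0 mulr0.
rewrite coord_sumP coord_sum_rho comb_coord.
have [ij|_] := eqVneq i j; have [ik|_] := eqVneq i k;
  rewrite ?mulr1n ?mulr0n; try by split; lra.
by move: Ejk; rewrite -ij -ik irrE.
Qed.

Lemma edge_cone_sum T E x : edge_cone T E x ->
  exists (n : nat) (t : 'I_n -> R) (y : 'I_n -> 'rV[R]_d),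
    [/\ forall k, 0 <= t k,
        forall k, exists i j, E i j /\ y k = rho R i j
      & x = \sum_k t k *: y k].
Proof.
elim=> [|t i j {}x t0 _ Eij _ [n [s [y [s0 yE ->]]]]].
  by exists 0%N, (fun=> 0), (fun=> 0); split=> [[]|[]|] //; rewrite big_ord0.
exists n.+1, (fun k => oapp s t (unlift ord0 k)),
  (fun k => oapp y (rho R i j) (unlift ord0 k)); split=> [k|k|].
- by case: (unlift _ k) => [k'|] //=; exact: ltW.
- by case: (unlift _ k) => [k'|] /=; [exact: yE | exists i, j].
- rewrite big_ord_recl unlift_none /=; congr (_ + _).
  by apply: eq_bigr => k _; rewrite liftK.
Qed.

(** * The polytope as a slice of the cone, and its lattice points *)

Lemma coord_sum_comb n (t : 'I_n -> R) (y : 'I_n -> 'rV[R]_d) :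
  (forall k, coord_sum (y k) = 2) ->
  coord_sum (\sum_k t k *: y k) = 2 * \sum_k t k.
Proof.
move=> y2; rewrite mulr_sumr.
elim/big_ind2: _ => [|x u x' u' <- <-|k _]; first exact: coord_sum0.
  by rewrite -{1}[u]scale1r coord_sumP mul1r.
by rewrite coord_sumZ y2; ring.
Qed.

(** Every [rho] has coordinate sum 2, so the weights of a combination add up to 1 exactly when its
    coordinate sum is 2. *)
Lemma edge_polytopeP E x :
  edge_polytope R E x <-> edge_cone predT E x /\ coord_sum x = 2.
Proof.
split.
  move=> [n [t [y [t0 t1 yE ->]]]]; split; last first.
    rewrite coord_sum_comb ?t1 ?mulr1 // => k.
    by have [i [j [_ ->]]] := yE k; rewrite coord_sum_rho.
  elim/big_ind: _ => [|u v|k _]; [by left | exact: edge_cone_add |].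
  have [i [j [Eij ->]]] := yE k; have := t0 k.
  rewrite le_eqVlt => /predU1P[<-|tk0]; first by rewrite scale0r; left.
  exact: edge_cone1.
move=> [/edge_cone_sum[n [t [y [t0 yE ->]]]]].
rewrite coord_sum_comb => [t2|k]; last first.
  by have [i [j [_ ->]]] := yE k; rewrite coord_sum_rho.
by exists n, t, y; split=> //; lra.
Qed.

Lemma edge_polytope_sub E G :
  subrel E G -> edge_polytope R E `<=` edge_polytope R G.
Proof.
move=> EG x /edge_polytopeP[Ex x2]; apply/edge_polytopeP; split=> //.
exact: edge_cone_sub Ex.
Qed.

Lemma edge_polytope_rho E i j : E i j -> edge_polytope R E (rho R i j).
Proof.
move=> Eij; apply/edge_polytopeP; rewrite coord_sum_rho; split=> //.
by rewrite -[rho R i j]scale1r; exact: edge_cone1.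
Qed.

Lemma rho_lattice i j : lattice (rho R i j).
Proof.
by apply/mxOverP => u v; rewrite ord1 rho_coord rpredD ?rpred_nat.
Qed.

Lemma pos_int_ge1 t : t \is a Num.int -> 0 < t -> 1 <= t.
Proof.
by move=> tZ t0; rewrite -(gtr0_norm t0) norm_intr_ge1 // gt_eqF.
Qed.

(** All coordinates are at most 1. At the two ends of any edge used with positive weight they are
    positive integers, hence equal to 1; this exhausts the sum 2 and the other coordinates
    vanish. *)
Lemma edge_polytope_lattice E x : irreflexive E ->
  edge_polytope R E x -> lattice x -> exists i j, E i j /\ x = rho R i j.
Proof.
move=> irrE /edge_polytopeP[Ex x2] /mxOverP xZ.
have xE i := edge_cone_coord i irrE Ex.
case xdef: {1}x / Ex => [|t i j y t0 _ Eij Ey].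
  by move: x2; rewrite xdef coord_sum0 => /eqP; rewrite eq_sym pnatr_eq0.
exists i, j; split=> //; rewrite -xdef.
have x1 k : 0 < rho R i j 0 k -> x 0 k = 1.
  move=> rk; have [_ xk] := xE k; apply/eqP; rewrite eq_le; apply/andP.
  split; first by lra.
  apply: pos_int_ge1; first exact: xZ.
  have [yk _] := edge_cone_coord k irrE Ey.
  by rewrite xdef comb_coord -rho_coord ltr_pwDl // mulr_gt0.
have nij : i != j by apply: contraTneq Eij => ->; rewrite irrE.
have xi : x 0 i = 1.
  by apply: x1; rewrite rho_coord eqxx (negPf nij) addr0.
have xj : x 0 j = 1.
  by apply: x1; rewrite rho_coord eqxx eq_sym (negPf nij) add0r.
have : \sum_(k | (k != i) && (k != j)) x 0 k = 0.
  move: x2; rewrite /coord_sum (bigD1 i) //= (bigD1 j) 1?eq_sym //= xi xj.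
  by move=> ?; lra.
move/eqP; rewrite psumr_eq0 => [/allP x0|k _]; last by case: (xE k).
apply/rowP => k; rewrite rho_coord.
have [->|ki] := eqVneq k i; first by rewrite xi (negPf nij) addr0.
have [->|kj] := eqVneq k j; first by rewrite xj add0r.
by have := x0 k (mem_index_enum _); rewrite ki kj /= => /eqP ->; rewrite addr0.
Qed.

Lemma int_edge_cone_seq E x : edge_cone Num.int E x ->
  exists s : seq 'rV[R]_d, x = \sum_(y <- s) y /\
    {in s, forall y, exists i j, E i j /\ y = rho R i j}.
Proof.
elim=> [|t i j {}x t0 tZ Eij _ [s [-> sE]]].
  by exists [::]; rewrite big_nil.
have /natrP[n tn] : t \is a Num.nat by rewrite natrEint tZ ltW.
exists (nseq n (rho R i j) ++ s); rewrite big_cat /= big_nseq; split.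
  by rewrite tn scaler_nat -Monoid.iteropE.
by move=> y; rewrite mem_cat mem_nseq => /orP[/andP[_ /eqP ->]|/sE//]; exists i, j.
Qed.

Lemma coord_sum_seq (s : seq 'rV[R]_d) :
  {in s, forall y, coord_sum y = 2} ->
  coord_sum (\sum_(y <- s) y) = 2 * (size s)%:R.
Proof.
elim: s => [|y s IH] s2; first by rewrite big_nil coord_sum0 mulr0.
rewrite big_cons -{1}[y]scale1r coord_sumP IH => [|z zs]; last first.
  by apply: s2; rewrite in_cons zs orbT.
by rewrite s2 ?mem_head //= -natr1; ring.
Qed.

(** * Trading edges across the hyperplane *)

Definition nonneg_edges G (h : 'rV[R]_d -> R) : rel 'I_d :=
  [rel i j | G i j && (0 <= h (rho R i j))].

Definition nonpos_edges G (h : 'rV[R]_d -> R) : rel 'I_d :=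
  [rel i j | G i j && (h (rho R i j) <= 0)].

(** This is all that the cone arguments need from the combinatorics of [G]. The new pair has
    [h = 0], so it belongs to both [nonneg_edges] and [nonpos_edges]. *)
Definition tradable G (h : 'rV[R]_d -> R) : Prop :=
  forall i j k l, G i j -> G k l -> 0 < h (rho R i j) -> h (rho R k l) < 0 ->
  exists i' j' k' l',
    [/\ G i' j', G k' l', h (rho R i' j') = 0, h (rho R k' l') = 0
      & rho R i j + rho R k l = rho R i' j' + rho R k' l'].

Section Trade.
Variables (G : rel 'I_d) (h : 'rV[R]_d -> R).
Hypothesis trade : tradable G h.

Lemma edge_cone_trade T t i j k l : 0 < t -> t \in T -> G i j -> G k l ->
  0 < h (rho R i j) -> h (rho R k l) < 0 ->
  edge_cone T (nonneg_edges G h) (t *: (rho R i j + rho R k l)) /\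
  edge_cone T (nonpos_edges G h) (t *: (rho R i j + rho R k l)).
Proof.
move=> t0 tT Gij Gkl hij hkl.
have [i' [j' [k' [l' [G1 G2 h1 h2 ->]]]]] := trade Gij Gkl hij hkl.
by rewrite scalerDr; split; apply: edge_cone_add; apply: edge_cone1;
  rewrite // /nonneg_edges /nonpos_edges /= ?h1 ?h2 ?lexx ?G1 ?G2.
Qed.

(** The new negative edge is traded against the positive edges of [x] one by one, each time with the
    smaller of the two coefficients. What remains is a difference of coefficients, whence the
    closure of [T] under subtraction. *)
Lemma edge_cone_addn T x t k l : GRing.subr_closed T ->
  edge_cone T (nonneg_edges G h) x -> 0 < t -> t \in T ->
  G k l -> h (rho R k l) < 0 ->
  edge_cone T (nonneg_edges G h) (t *: rho R k l + x) \/
  edge_cone T (nonpos_edges G h) (t *: rho R k l + x).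
Proof.
move=> TB Cx + + Gkl hkl.
elim: Cx t => [|s i j {}x s0 sT /andP[Gij hij] Cx IH] t t0 tT.
  by right; rewrite addr0; apply: edge_cone1; rewrite // /nonpos_edges /= Gkl ltW.
(* An edge on the hyperplane fits either outcome, so it is set aside and put back after the
   induction. *)
move: hij; rewrite le_eqVlt => /predU1P[hij|hij].
  rewrite addrCA; have [C|C] := IH t t0 tT; [left|right];
  by apply: EdgeConeD; rewrite // /nonneg_edges /nonpos_edges /= Gij -hij lexx.
have [ts|st|ts] := ltgtP t s.
- left; have [C _] := edge_cone_trade t0 tT Gij Gkl hij hkl.
  have -> : t *: rho R k l + (s *: rho R i j + x) =
    t *: (rho R i j + rho R k l) + ((s - t) *: rho R i j + x).
    by apply/rowP => u; rewrite !mxE; ring.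
  apply: edge_cone_add => //; apply: EdgeConeD => //.
  + by rewrite subr_gt0.
  + exact: TB.
  + by rewrite /nonneg_edges /= Gij ltW.
- have [C C'] := edge_cone_trade s0 sT Gij Gkl hij hkl.
  have -> : t *: rho R k l + (s *: rho R i j + x) =
    s *: (rho R i j + rho R k l) + ((t - s) *: rho R k l + x).
    by apply/rowP => u; rewrite !mxE; ring.
  have [||D|D] := IH (t - s); rewrite ?subr_gt0 ?TB //; [left|right];
    exact: edge_cone_add.
- left; have [C _] := edge_cone_trade s0 sT Gij Gkl hij hkl.
  by rewrite ts addrA -scalerDr [rho R k l + _]addrC; exact: edge_cone_add.
Qed.

End Trade.

(** * Normality of the two halves *)

Section Sides.
Variables (G : rel 'I_d) (h : 'rV[R]_d -> R).
Hypothesis trade : tradable G h.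

Lemma tradable_opp : tradable G (fun x => - h x).
Proof.
move=> i j k l; rewrite oppr_gt0 oppr_lt0 => Gij Gkl hij hkl.
have [i' [j' [k' [l' [G1 G2 h1 h2 e]]]]] := trade Gkl Gij hkl hij.
by exists i', j', k', l'; rewrite h1 h2 oppr0 addrC.
Qed.

Lemma edge_cone_union T x : GRing.subr_closed T -> edge_cone T G x ->
  edge_cone T (nonneg_edges G h) x \/ edge_cone T (nonpos_edges G h) x.
Proof.
move=> TB; elim=> [|t i j {}x t0 tT Gij _ [C|C]]; first by left; left.
  have [hij|hij] := leP 0 (h (rho R i j)); last exact: edge_cone_addn.
  by left; apply: EdgeConeD; rewrite // /nonneg_edges /nonpos_edges /= Gij.
have [hij|hij] := leP (h (rho R i j)) 0.
  by right; apply: EdgeConeD; rewrite // /nonneg_edges /nonpos_edges /= Gij.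
have C' : edge_cone T (nonneg_edges G (fun u => - h u)) x.
  by apply: edge_cone_sub C => u v; rewrite /nonneg_edges /= oppr_ge0.
have hij' : - h (rho R i j) < 0 by rewrite oppr_lt0.
have [D|D] := edge_cone_addn tradable_opp TB C' t0 tT Gij hij'; [right|left];
  by apply: edge_cone_sub D => u v;
    rewrite /nonneg_edges /nonpos_edges /= ?oppr_ge0 ?oppr_le0.
Qed.

Hypothesis hP : forall t x y, h (t *: x + y) = t * h x + h y.

Lemma additive0 : h 0 = 0.
Proof. by have := hP 1 0 0; rewrite scaler0 addr0 => ?; lra. Qed.

Lemma edge_cone_nonneg T x : edge_cone T (nonneg_edges G h) x -> 0 <= h x.
Proof.
elim=> [|t i j {}x t0 tT /andP[_ hij] _ IH]; first by rewrite additive0.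
by rewrite hP addr_ge0 // mulr_ge0 // ltW.
Qed.

(** If a sum of nonpositive terms is nonnegative, every term is zero, so only edges on the
    hyperplane occur. The bound on [h x] is carried along because the induction needs it for the
    tail. *)
Lemma edge_cone_nonpos T x : edge_cone T (nonpos_edges G h) x ->
  h x <= 0 /\ (0 <= h x -> edge_cone T (nonneg_edges G h) x).
Proof.
elim=> [|t i j {}x t0 tT /andP[Gij hij] _ [hx IH]].
  by rewrite additive0; split=> // _; left.
have thij : t * h (rho R i j) <= 0 by rewrite pmulr_rle0.
rewrite hP; split=> [|hge]; first lra.
have : t * h (rho R i j) = 0 by lra.
move/eqP; rewrite mulf_eq0 gt_eqF //= => /eqP h0.
by apply: EdgeConeD; rewrite // /nonneg_edges /= ?Gij ?h0 ?lexx //; apply: IH; lra.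
Qed.

(** Normality of the whole polytope writes [beta] as an integral combination of edges of [G];
    trading with integer coefficients then moves it into the half. *)
Lemma normal_side : irreflexive G ->
  normal_polytope (edge_polytope R G) ->
  normal_polytope (edge_polytope R (nonneg_edges G h)).
Proof.
move=> irrG nG N beta N0 [[x Px xbeta] Zbeta].
have Gpsub : subrel (nonneg_edges G h) G by move=> i j /andP[].
have [|betas [betasP betaE]] := nG N beta N0.
  by split=> //; exists x => //; exact: edge_polytope_sub Px.
have /edge_polytopeP[Cx x2] := Px.
have Cbeta : edge_cone Num.int G beta.
  rewrite betaE; elim/big_ind: _ => [|u v|k _]; [by left|exact: edge_cone_add|].
  have [Pk Zk] := betasP k.
  have [i [j [Gij ->]]] := edge_polytope_lattice irrG Pk Zk.
  by rewrite -[rho R i j]scale1r; apply: edge_cone1 => //; exact: rpred1.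
have hbeta : 0 <= h beta.
  rewrite -xbeta -[_ *: _]addr0 hP additive0 addr0 mulr_ge0 //.
  exact: edge_cone_nonneg Cx.
(* Should the trade end on the nonpositive side, [hbeta] forces all remaining edges onto the
   hyperplane. *)
have {Cbeta} : edge_cone Num.int (nonneg_edges G h) beta.
  have intB : GRing.subr_closed (Num.int : {pred R}) by move=> u v; exact: rpredB.
  by have [//|C] := edge_cone_union intB Cbeta; case: (edge_cone_nonpos C) => _; exact.
move=> /int_edge_cone_seq[s [sE sG]].
(* Trading does not record the number of edges; it is recovered from the coordinate sum, to which
   each edge contributes 2. *)
have sN : size s = N.
  have : coord_sum beta = 2 * N%:R.
    by rewrite -xbeta coord_sumZ x2; ring.
  rewrite sE coord_sum_seq => [|y /sG[i [j [_ ->]]]]; last exact: coord_sum_rho.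
  have two0 : (2 : R) != 0 by rewrite pnatr_eq0.
  by move/(mulfI two0)/eqP; rewrite eqr_nat => /eqP.
exists (fun k => nth 0 s k); split=> [k|].
  have [|i [j [Gij ->]]] := sG (nth 0 s k); first by rewrite mem_nth // sN.
  by split; [exact: edge_polytope_rho | exact: rho_lattice].
by rewrite sE (big_nth 0) big_mkord sN.
Qed.

(** Trading with real coefficients puts [x] into one of the two halves, whose normality supplies the
    summands. *)
Lemma normal_union :
  normal_polytope (edge_polytope R (nonneg_edges G h)) ->
  normal_polytope (edge_polytope R (nonpos_edges G h)) ->
  normal_polytope (edge_polytope R G).
Proof.
move=> np nn N beta N0 [[x /edge_polytopeP[Cx x2] xbeta] Zbeta].
have side E : subrel E G -> edge_cone predT E x ->
    normal_polytope (edge_polytope R E) ->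
    exists betas : 'I_N -> 'rV[R]_d,
      (forall k, (edge_polytope R G `&` @lattice R d) (betas k)) /\
      beta = \sum_k betas k.
  move=> EG Ex /(_ N beta N0)[|betas [bP bE]].
    by split=> //; exists x => //; apply/edge_polytopeP.
  exists betas; split=> // k; have [Pk Zk] := bP k.
  by split=> //; exact: edge_polytope_sub Pk.
by have [C|C] := edge_cone_union (fun _ _ _ _ => isT) Cx;
  [apply: side np | apply: side nn]; rewrite // => i j /andP[].
Qed.

End Sides.

(** * Edges strictly on opposite sides of the hyperplane *)

Section Crossing.
Variables (G : rel 'I_d) (h : 'rV[R]_d -> R).
Hypotheses (symG : symmetric G) (irrG : irreflexive G).
Hypothesis hP : forall t x y, h (t *: x + y) = t * h x + h y.
Hypothesis intG :
  integral_polytope (edge_polytope R G `&` [set x | 0 <= h x]).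

(** The sign condition is a product so that the two edges play symmetric roles; the next lemmas then
    reduce every labelling to one. *)
Definition crossing i j k l :=
  [/\ G i j, G k l & h (rho R i j) * h (rho R k l) < 0].

Lemma crossingC i j k l : crossing i j k l -> crossing k l i j.
Proof. by move=> [? ? ?]; split=> //; rewrite mulrC. Qed.

Lemma crossingCl i j k l : crossing i j k l -> crossing j i k l.
Proof. by move=> [? ? ?]; split=> //; rewrite ?(symG j) // rhoC. Qed.

Lemma crossingCr i j k l : crossing i j k l -> crossing i j l k.
Proof. by move=> [? ? ?]; split=> //; rewrite ?(symG l) // (rhoC l). Qed.

Lemma edge_neq i j : G i j -> i != j.
Proof. by apply: contraTneq => ->; rewrite irrG. Qed.

(** A sum of nonnegative terms vanishes only if each term does, which leaves only edges with the two
    given vectors. *)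
Lemma edge_cone_face (c : 'I_d -> R) i j k l x :
  (forall u v, G u v -> 0 <= c u + c v) ->
  (forall u v, G u v -> c u + c v = 0 ->
     rho R u v = rho R i j \/ rho R u v = rho R k l) ->
  edge_cone predT G x ->
  0 <= linear_form c x /\
  (linear_form c x = 0 -> exists s t, x = s *: rho R i j + t *: rho R k l).
Proof.
move=> c0 cE; elim=> [|t u v {}x t0 _ Guv _ [lx IH]].
  split=> [|_]; last by exists 0, 0; rewrite !scale0r addr0.
  by rewrite linear_form0.
have cuv := c0 u v Guv; have tcuv : 0 <= t * (c u + c v) by rewrite mulr_ge0 // ltW.
rewrite linear_formP linear_form_rho; split=> [|l0]; first lra.
have [|s [s' ->]] := IH; first lra.
have : t * (c u + c v) = 0 by lra.
move/eqP; rewrite mulf_eq0 gt_eqF //= => /eqP /(cE u v Guv)[->|->].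
  by exists (t + s), s'; rewrite scalerDl addrA.
by exists s, (t + s'); rewrite scalerDl addrCA.
Qed.

(* The form [c] exposes the segment from [rho i j] to [rho k l] as a face. *)
Lemma exposed_segment (c : 'I_d -> R) i j k l :
  (forall u v, G u v -> 0 <= c u + c v) ->
  (forall u v, G u v -> c u + c v = 0 ->
     rho R u v = rho R i j \/ rho R u v = rho R k l) ->
  c i + c j = 0 -> c k + c l = 0 -> ~ crossing i j k l.
Proof.
move=> c0 cE cij ckl [Gij Gkl]; set r1 := rho R i j; set r2 := rho R k l => hlt.
have h12 : h r1 - h r2 != 0 by apply: contraTneq hlt => ?; rewrite -leNgt; nra.
(* The root of [h] along the segment: [z] below is where the segment crosses the hyperplane. *)
pose t := - h r2 / (h r1 - h r2).
have tE : t * (h r1 - h r2) = - h r2 by rewrite /t divfK.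
have t01 : 0 < t < 1 by apply/andP; split; nra.
pose z := t *: r1 + (1 - t) *: r2.
have h0 : h 0 = 0 := additive0 hP.
have hZ s x : h (s *: x) = s * h x by rewrite -[_ *: _]addr0 hP h0 addr0.
have onface x : edge_polytope R G x -> linear_form c x = 0 ->
    exists s, x = s *: r1 + (1 - s) *: r2.
  move=> /edge_polytopeP[Cx x2] cx.
  have [_ /(_ cx)[s [s' xE]]] := edge_cone_face c0 cE Cx.
  exists s; rewrite xE; congr (_ + _ *: _); move: x2.
  rewrite xE coord_sumP coord_sumZ !coord_sum_rho.
  by move=> ?; lra.
have onH x : edge_polytope R G x -> linear_form c x = 0 -> h x = 0 -> x = z.
  move=> Px cx; have [s ->] := onface x Px cx; rewrite hP hZ => hx.
  suff -> : s = t by [].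
  by apply: (mulIf h12); rewrite tE; lra.
have cz : linear_form c z = 0.
  by rewrite linear_formP linear_formZ !linear_form_rho cij ckl; ring.
have hz : h z = 0 by rewrite hP hZ; lra.
have Pz : edge_polytope R G z.
  apply/edge_polytopeP; split; last first.
    by rewrite coord_sumP coord_sumZ !coord_sum_rho; ring.
  by apply: edge_cone_add; apply: edge_cone1 => //; rewrite ?subr_gt0; case/andP: t01.
have /mxOverP zZ : lattice z.
  apply: intG; split; first by split=> //=; rewrite hz.
  move=> x y s [Px /= hx] [Py /= hy] /andP[s0 s1] zE.
  (* Both [linear_form c] and [h] are nonnegative at [x] and [y] and vanish at [z], strictly between
     them. So both vanish at [x] and [y], and [onH] identifies these points with [z]. *)
  have cge u : edge_polytope R G u -> 0 <= linear_form c u.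
    by move=> /edge_polytopeP[Cu _]; case: (edge_cone_face c0 cE Cu).
  have cx := cge x Px; have cy := cge y Py.
  move: cz hz; rewrite {1 2}zE linear_formP linear_formZ hP hZ => cxy hxy.
  by split; apply: onH => //; nra.
(* An end of the first edge that is not an end of the second: there [z] has coordinate [t], which is
   no integer. If there were none, [r1] and [r2] would coincide. *)
have [m [m1 m2]] : exists m, r1 0 m = 1 /\ r2 0 m = 0.
  have ij := edge_neq Gij.
  have [ikl|] := boolP (i \in [:: k; l]); last first.
    rewrite !inE negb_or => /andP[/negPf ik /negPf il].
    by exists i; rewrite /r1 /r2 !rho_coord ik il eqxx (negPf ij) !addr0.
  have [jkl|] := boolP (j \in [:: k; l]); last first.
    rewrite !inE negb_or => /andP[/negPf jk /negPf jl].
    by exists j; rewrite /r1 /r2 !rho_coord jk jl eqxx eq_sym (negPf ij) addr0 add0r.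
  suff r12 : r1 = r2 by move: h12; rewrite r12 subrr eqxx.
  move: ikl jkl ij; rewrite /r1 /r2 !inE.
  by move=> /orP[] /eqP -> /orP[] /eqP ->; rewrite ?eqxx // rhoC.
have := zZ 0 m; rewrite comb_coord -rho_coord -/r1 m1.
rewrite mxE -/r2 m2 mulr1 mulr0 addr0 => /pos_int_ge1.
by case/andP: t01 => t0 t1 /(_ t0); lra.
Qed.

Lemma not_crossing_adjacent i j l : ~ crossing i j i l.
Proof.
move=> cr; have [Gij Gil _] := cr.
have ij := edge_neq Gij; have il := edge_neq Gil.
(* Edges at [i] get weight 0 when they end in [j] or [l] and 2 otherwise; edges avoiding [i] get at
   least 2. *)
pose c u : R := if u == i then -1 else if (u == j) || (u == l) then 1 else 3.
have cjl u : (u == j) || (u == l) -> c u = 1.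
  by rewrite /c => /orP[]/eqP->;
    rewrite ![_ == i]eq_sym ?(negPf ij) ?(negPf il) eqxx ?orbT.
have ci : c i = -1 by rewrite /c eqxx.
have cj : c j = 1 by rewrite cjl ?eqxx.
have cl : c l = 1 by rewrite cjl ?eqxx ?orbT.
apply: (@exposed_segment c) cr; rewrite ?ci ?cj ?cl ?addNr //.
- move=> u v Guv; have := edge_neq Guv; rewrite /c.
  have [->|_] := eqVneq u i; have [_|_] := eqVneq v i; rewrite ?eqxx //;
  by case: ifP; try case: ifP; move=> *; lra.
- move=> u v Guv; have := edge_neq Guv; rewrite /c.
  have [->|_] := eqVneq u i; have [->|_] := eqVneq v i; rewrite ?eqxx // => _.
  + by case: ifP => [/orP[]/eqP-> _|_ ?]; [left|right|exfalso; lra].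
  + by case: ifP => [/orP[]/eqP-> _|_ ?]; [left; exact: rhoC|right; exact: rhoC|exfalso; lra].
  + by case: ifP; case: ifP => *; exfalso; lra.
Qed.

Lemma crossing_disjoint i j k l : crossing i j k l ->
  [/\ i != k, i != l, j != k & j != l].
Proof.
move=> cr; split; apply/eqP => e; move: cr; rewrite e.
- exact: not_crossing_adjacent.
- by move/crossingCr; exact: not_crossing_adjacent.
- by move/crossingCl; exact: not_crossing_adjacent.
- by move/crossingCl/crossingCr; exact: not_crossing_adjacent.
Qed.

(** Otherwise the segment between the two edges is exposed by the weights -1 at [j], 1 at [i], 0 at
    [k] and [l], and 2 elsewhere: the only pairs of negative weight, [j k] and [j l], are not
    edges. *)
Lemma crossing_neighbor i j k l :
  crossing i j k l -> G j k || G j l.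
Proof.
move=> cr; have [Gij Gkl _] := cr.
have ij := edge_neq Gij; have kl := edge_neq Gkl.
have [ik il jk jl] := crossing_disjoint cr.
apply/negPn/negP; rewrite negb_or => /andP[Njk Njl].
pose c u : R := if u == j then -1 else if u == i then 1
  else if (u == k) || (u == l) then 0 else 2.
have cj : c j = -1 by rewrite /c eqxx.
have ci : c i = 1 by rewrite /c eqxx (negPf ij).
have ckl u : (u == k) || (u == l) -> c u = 0.
  rewrite /c => ukl; rewrite ukl; move: ukl => /orP[]/eqP->;
  by rewrite ![_ == j]eq_sym ![_ == i]eq_sym ?(negPf ik) ?(negPf il) ?(negPf jk) ?(negPf jl).
have cases u : [\/ u = j, u = i, (u == k) || (u == l) /\ c u = 0 | c u = 2].
  have [ukl|] := boolP ((u == k) || (u == l)).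
    by constructor 3; split; last exact: ckl.
  rewrite /c => /negPf ->; have [->|_] := eqVneq u j; first by constructor 1.
  have [->|_] := eqVneq u i; first by constructor 2.
  by constructor 4.
have edge u v : G u v -> [\/ 0 < c u + c v,
    rho R u v = rho R i j /\ c u + c v = 0 |
    rho R u v = rho R k l /\ c u + c v = 0].
  move=> Guv; move: (Guv) (edge_neq Guv).
  case: (cases u) => [->|->|[ukl cu]|cu];
    case: (cases v) => [->|->|[vkl cv]|cv]; rewrite ?eqxx // => Guv' nuv;
    try by constructor 1; lra.
  - by constructor 2; rewrite rhoC; split=> //; lra.
  - by move: vkl Guv' => /orP[]/eqP->; rewrite ?(negPf Njk) ?(negPf Njl).
  - by constructor 2; split=> //; lra.
  - by move: ukl Guv' => /orP[]/eqP->; rewrite symG ?(negPf Njk) ?(negPf Njl).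
  - constructor 3; split; last by lra.
    by move: ukl vkl nuv => /orP[]/eqP-> /orP[]/eqP->; rewrite ?eqxx // rhoC.
apply: (@exposed_segment c) cr; rewrite ?ci ?cj ?ckl ?eqxx ?orbT //; try lra.
- by move=> u v /edge[|[_ ->]|[_ ->]] //; exact: ltW.
- by move=> u v /edge[+ e|[? _]|[? _]]; [rewrite e ltxx|left|right].
Qed.

(** Each of the four ends has a neighbor on the opposite edge, and a bipartite graph on two plus two
    vertices with no isolated vertex has a perfect matching. *)
Lemma crossing_square i j k l :
  crossing i j k l -> (G i k && G j l) || (G i l && G j k).
Proof.
move=> cr.
have := crossing_neighbor cr; have := crossing_neighbor (crossingCl cr).
have := crossing_neighbor (crossingC cr).
have := crossing_neighbor (crossingCl (crossingC cr)).
rewrite (symG k) (symG l) (symG k j) (symG l j).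
by case: (G i k); case: (G i l); case: (G j k); case: (G j l).
Qed.

(** The edge [i k] meets both crossing edges, and edges with a common end never cross; so [h] has
    there a sign opposite to neither of two opposite signs. *)
Lemma crossing_side i j k l : crossing i j k l -> G i k -> h (rho R i k) = 0.
Proof.
move=> [Gij Gkl hlt] Gik.
have h1 : 0 <= h (rho R i j) * h (rho R i k).
  by rewrite leNgt; apply/negP => ?; apply: (@not_crossing_adjacent i j k).
have h2 : 0 <= h (rho R k l) * h (rho R i k).
  rewrite leNgt; apply/negP => hl; apply: (@not_crossing_adjacent k l i).
  by split=> //; rewrite ?(symG k i) // (rhoC k i).
have [r0|r0|//] := ltgtP (h (rho R i k)) 0; move: h1 h2 hlt.
  by rewrite !nmulr_lge0 // => h1 h2; rewrite ltNge mulr_le0.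
by rewrite !pmulr_lge0 // => h1 h2; rewrite ltNge mulr_ge0.
Qed.

Lemma crossing_trade : tradable G h.
Proof.
move=> i j k l Gij Gkl hij hkl.
have cr : crossing i j k l by split=> //; rewrite pmulr_rlt0.
have [/andP[G1 G2]|/andP[G1 G2]] := orP (crossing_square cr).
  exists i, k, j, l; split=> //; first exact: crossing_side cr G1.
    exact: crossing_side (crossingCl (crossingCr cr)) G2.
  by rewrite /rho addrACA.
exists i, l, j, k; split=> //; first exact: crossing_side (crossingCr cr) G1.
  exact: crossing_side (crossingCl cr) G2.
by rewrite (rhoC k) /rho addrACA.
Qed.

End Crossing.

End Edges.

(* From the affine hyperplane to a homogeneous form *)
Local Close Scope classical_set_scope.

Theorem theorem3p2 (R : realType) (d : nat) (G : rel 'I_d)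
    (symG : symmetric G) (irrG : irreflexive G)
    (connG : forall i j : 'I_d, connect G i j)
    (a : 'rV[R]_d) (b : R)
    (sepH : separating_hyperplane a b (edge_polytope R G)) :
  normal_polytope (edge_polytope R G) <->
  normal_polytope (edge_polytope R (edges_in G (halfspace_pos a b))) /\
  normal_polytope (edge_polytope R (edges_in G (halfspace_neg a b))).
Proof.
(* On vectors with coordinate sum 2 the homogeneous form [h] is [dot a x - b]. *)
pose h (x : 'rV[R]_d) := linear_form (fun i => a 0 i - b / 2) x.
have hE x : coord_sum x = 2 -> h x = dot a x - b.
  move=> x2; rewrite /h /linear_form; under eq_bigr do rewrite mulrBl.
  rewrite sumrB -mulr_sumr -/(coord_sum x) x2 divfK ?pnatr_eq0 //.
have hP t x y : h (t *: x + y) = t * h x + h y by exact: linear_formP.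
have hrho i j : h (rho R i j) = dot a (rho R i j) - b.
  by rewrite hE // coord_sum_rho.
case: sepH => _ _ _ intp _.
(* On the polytope the coordinate sum is 2, so the affine half-space and the half-space of [h] cut
   out the same set. *)
have intG : integral_polytope (edge_polytope R G `&` [set x | 0 <= h x])%classic.
  suff <- : (edge_polytope R G `&` halfspace_pos a b =
             edge_polytope R G `&` [set x | 0 <= h x])%classic by [].
  by apply/seteqP; split=> x [Px hx]; split=> //;
    move: hx; rewrite /halfspace_pos /= hE ?subr_ge0 //;
    case/edge_polytopeP: Px.
have trade := crossing_trade symG irrG hP intG.
have -> : edges_in G (halfspace_pos a b) = nonneg_edges G h.
  apply/funext => i; apply/funext => j /=; congr (_ && _).
  by apply/idP/idP; rewrite inE /halfspace_pos /= hrho subr_ge0.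
have En : edges_in G (halfspace_neg a b) = nonpos_edges G h.
  apply/funext => i; apply/funext => j /=; congr (_ && _).
  by apply/idP/idP; rewrite inE /halfspace_neg /= hrho subr_le0.
rewrite En; split=> [nG|[np nn]]; last exact: normal_union np nn.
split; first exact: normal_side.
(* Changing the sign of [h] exchanges the halves and preserves tradability, so [normal_side] applies
   again. *)
have -> : nonpos_edges G h =
          nonneg_edges G (fun x => - h x).
  by apply/funext => i; apply/funext => j; rewrite /nonneg_edges /= oppr_ge0.
apply: (normal_side (tradable_opp trade)) nG => // t x y.
by rewrite hP; ring.
Qed.
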